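(* Let $Q\in\mathbb{R}^{m\times m}$, $B\in\mathbb{R}^{n\times m}$, $b\in\mathbb{R}^n$ be the data of the binary quadratic problem $\min\{x^{\mathrm T}Qx : Bx=b,\ x\in\{0,1\}^m\}$. Let $v_{GGL}$ be the Generalized Gilmore-Lawler bound produced by a run of the Generalized Gilmore-Lawler scheme (with any choice of skew-symmetric matrices in the scheme), and let $v_{LBB'}$ be the linearization-based bound, both as defined in the context. Then $$v_{GGL}\le v_{LBB'}.$$
   Context: Inequalities between vectors or matrices are entrywise. $\mathrm{Diag}(z)$ is the diagonal matrix with diagonal $z$, and $I_k$ is the $k$-th column of the $m\times m$ identity matrix. Set $\bar K=\{x\in\mathbb{R}^m : x\ge 0,\ Bx=b\}$. Optimal values are taken in $\mathbb{R}\cup\{\pm\infty\}$ ($-\infty$ for an infeasible maximization problem, $+\infty$ for an infeasible minimization problem). **Dual-update data.** For a matrix $M=[q_1,\dots,q_m]\in\mathbb{R}^{m\times m}$ with columns $q_k$, for each $k=1,\dots,m$ let $(\bar y_k,\bar z_k)\in\mathbb{R}^n\times\mathbb{R}$ be an optimal solution of the linear program $\max\{b^{\mathrm T}y_k+z_k : B^{\mathrm T}y_k+I_kz_k\le q_k\}$. Let $\bar Y=[\bar y_1,\dots,\bar y_m]\in\mathbb{R}^{n\times m}$, $\bar z=(\bar z_1,\dots,\bar z_m)^{\mathrm T}$, and define $\bar c=\bar Y^{\mathrm T}b+\bar z$ and $\bar M=B^{\mathrm T}\bar Y+\mathrm{Diag}(\bar z)$. **Generalized Gilmore-Lawler scheme.**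 Start with $Q_0=Q$, $c=0$. For $i=0,1,2,\dots$: compute $\bar c_i$ and $\bar Q_i$ as the vector $\bar c$ and the matrix $\bar M$ above with $M=Q_i$; replace $c$ by $c+\bar c_i$; set $Q_{i+1}=Q_i-\bar Q_i+S_{i+1}$ where $S_{i+1}\in\mathbb{R}^{m\times m}$ is a chosen skew-symmetric matrix; stop if $\bar c_i=0$. It is understood that all the linear programs occurring have optimal solutions and that the run stops after finitely many iterations. With $c$ the final (accumulated) vector, $v_{GGL}=\min_{x\in\bar K}c^{\mathrm T}x$. **Linearization-based bound $v_{LBB'}$.** Without affecting the binary quadratic problem the cost matrix is taken symmetric, i.e. $Q$ is replaced by $Q^s=\frac12(Q+Q^{\mathrm T})$, and $$v_{LBB'}=\max_{Y\in\mathbb{R}^{n\times m},\,z\in\mathbb{R}^m,\,y\in\mathbb{R}^n}\{b^{\mathrm T}y : B^{\mathrm T}y\le 2Y^{\mathrm T}b+z,\ B^{\mathrm T}Y+Y^{\mathrm T}B+\mathrm{Diag}(z)\le Q^s\}.$$ *)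

(* Defs.v *)
From HB Require Import structures.
From mathcomp Require Import all_boot all_order all_algebra.
From mathcomp Require Import classical_sets reals constructive_ereal ereal.
Set Implicit Arguments.
Unset Strict Implicit.
Unset Printing Implicit Defensive.
Import Order.TTheory GRing.Theory Num.Theory.
Local Open Scope classical_set_scope.
Local Open Scope ring_scope.

Definition lemx (R : realType) (p q : nat) (A A' : 'M[R]_(p, q)) : Prop :=
  forall i j, A i j <= A' i j.

Notation "A <=mx A'" := (lemx A A') (at level 70, no associativity).

Definition dot (R : realType) (p : nat) (u v : 'cV[R]_p) : R :=
  (u^T *m v) 0 0.

Section GilmoreLawler.
Variables (R : realType) (m n : nat).
Variables (B : 'M[R]_(n, m)) (b : 'cV[R]_n).

Definition Kbar : set 'cV[R]_m := [set x | 0 <=mx x /\ B *m x = b].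

Definition dual_feasible (q : 'cV[R]_m) (k : 'I_m) (y : 'cV[R]_n) (z : R) :
    Prop :=
  B^T *m y + z *: col k 1%:M <=mx q.

Definition dual_optimal (q : 'cV[R]_m) (k : 'I_m) (y : 'cV[R]_n) (z : R) :
    Prop :=
  dual_feasible q k y z /\
  (forall (y' : 'cV[R]_n) (z' : R),
      dual_feasible q k y' z' -> dot b y' + z' <= dot b y + z).

Definition dual_update (M : 'M[R]_m) (Y : 'M[R]_(n, m)) (z : 'cV[R]_m) : Prop :=
  forall k : 'I_m, dual_optimal (col k M) k (col k Y) (z k 0).

Definition cbar (Y : 'M[R]_(n, m)) (z : 'cV[R]_m) : 'cV[R]_m := Y^T *m b + z.

Definition Mbar (Y : 'M[R]_(n, m)) (z : 'cV[R]_m) : 'M[R]_m :=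
  B^T *m Y + diag_mx z^T.

(* [GGL_run M c c'] : the scheme, started an iteration with cost matrix [M] and
   accumulated vector [c], may stop after finitely many iterations with
   accumulated vector [c'].  The optimal dual solutions and the skew-symmetric
   matrices are free choices at each iteration. *)
Inductive GGL_run : 'M[R]_m -> 'cV[R]_m -> 'cV[R]_m -> Prop :=
| GGL_stop M c Y z :
    dual_update M Y z -> cbar Y z = 0 ->
    GGL_run M c (c + cbar Y z)
| GGL_step M c Y z (S : 'M[R]_m) c' :
    dual_update M Y z -> cbar Y z <> 0 -> S^T = - S ->
    GGL_run (M - Mbar Y z + S) (c + cbar Y z) c' ->
    GGL_run M c c'.

Definition v_GGL (c : 'cV[R]_m) : \bar R :=
  ereal_inf [set (dot c x)%:E | x in Kbar].

Definition symmetrize (Q : 'M[R]_m) : 'M[R]_m := 2^-1 *: (Q + Q^T).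

Definition LBB_feasible (Q : 'M[R]_m)
    (Y : 'M[R]_(n, m)) (z : 'cV[R]_m) (y : 'cV[R]_n) : Prop :=
  B^T *m y <=mx 2 *: (Y^T *m b) + z /\
  B^T *m Y + Y^T *m B + diag_mx z^T <=mx symmetrize Q.

Definition v_LBB' (Q : 'M[R]_m) : \bar R :=
  ereal_sup [set v | exists Y z y, LBB_feasible Q Y z y /\ v = (dot b y)%:E].

End GilmoreLawler.

(* Main.v *)
Require Import Defs.
From HB Require Import structures.
From mathcomp Require Import all_boot all_order all_algebra.
From mathcomp Require Import classical_sets reals constructive_ereal ereal.
From mathcomp Require Import ring lra.
Set Implicit Arguments.
Unset Strict Implicit.
Unset Printing Implicit Defensive.
Import Order.TTheory GRing.Theory Num.Theory.
Local Open Scope ring_scope.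

(** Summing the dual solutions found along a run gives [Y], [z] with
    [c = Y^T b + z] and [B^T Y + Diag z <= Q + W] for a skew-symmetric [W].
    Taking symmetric parts removes [W] and makes [Y / 2], [z] admissible for
    [v_LBB'], whose remaining constraint on [y] becomes [B^T y <= c]; linear
    programming duality then compares [v_LBB'] with the minimum of [c^T x].
    Duality is derived from a theorem of the alternative proved by
    Fourier-Motzkin elimination.  When [Kbar] is empty, Farkas gives an
    unbounded ray of the dual, which contradicts the existence of optimal
    solutions in the scheme unless [m = 0]. *)

(** Supplies the value of the variable removed in an elimination step; either list of bounds may be
    empty. *)
Lemma exists_between (R : realFieldType) (l u : seq R) :
  (forall x y, x \in l -> y \in u -> x <= y) ->
  exists t, (forall x, x \in l -> x <= t) /\ (forall y, y \in u -> t <= y).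
Proof.
elim: l => [_|x l IHl lu].
  elim: u => [|y u [t [_ tu]]]; first by exists 0.
  exists (Num.min y t); split=> // w; rewrite inE => /predU1P[->|/tu tw].
    by rewrite ge_min lexx.
  by rewrite ge_min tw orbT.
have [x' y x'l yu|t [lt tu]] := IHl; first by apply: lu; rewrite // inE x'l orbT.
exists (Num.max x t); split=> [w|y yu].
  rewrite inE => /predU1P[->|/lt wt]; first by rewrite le_max lexx.
  by rewrite le_max wt orbT.
by rewrite ge_max tu // lu // mem_head.
Qed.

Section Alternative.
Variable R : realFieldType.

Definition convex_cone (V : lmodType R) (C : V -> Prop) : Prop :=
  [/\ C 0, forall v w, C v -> C w -> C (v + w)
    & forall a v, 0 <= a -> C v -> C (a *: v)].

(* A pair [(a, d)] encodes the linear inequality [a y <= d]. *)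
Definition satisfies n (y : 'cV[R]_n) (p : 'rV[R]_n * R) : Prop :=
  (p.1 *m y) 0 0 <= p.2.

(* Quantifying over all cones containing the system avoids carrying the
   multipliers through the elimination. *)
Lemma fourier_motzkin n (s : seq ('rV[R]_n * R^o)) :
  (exists y, forall p, p \in s -> satisfies y p) \/
  (exists2 e : R^o, e < 0 & forall C : 'rV[R]_n * R^o -> Prop,
     convex_cone C -> (forall p, p \in s -> C p) -> C (0, e)).
Proof.
elim: n s => [|n IHn] s.
  have [/hasP[[a e] sp /= e0]|/hasPn s0] := boolP (has (fun p => p.2 < 0) s).
    by right; exists e => // C _ /(_ _ sp); rewrite [a]thinmx0.
  left; exists 0 => p /s0; rewrite -leNgt /satisfies => p0.
  by rewrite mulmx0 mxE.
move: s; rewrite -[n.+1]/(1 + n)%N => s.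
pose h (p : 'rV[R]_(1 + n) * R^o) := p.1 0 0.
pose tl (p : 'rV[R]_(1 + n) * R^o) : 'rV[R]_n * R^o := (rsubmx p.1, p.2).
pose P := [seq p <- s | 0 < h p]; pose N := [seq p <- s | h p < 0].
pose Z := [seq p <- s | h p == 0].
(* For [p] in [P] and [q] in [N] both multipliers are positive, and the first coefficient
   cancels. *)
pose comb p q := h p *: q + (- h q) *: p.
have [[y sy]|[e e0 eC]] := IHn (map tl Z ++ [seq tl (comb p q) | p <- P, q <- N]).
- left.
  (* With the other coordinates fixed to [y], this is the bound that [p] puts on the first one:
     upper for [p] in [P], lower for [p] in [N]. *)
  pose rest (p : 'rV[R]_(1 + n) * R^o) := (p.2 - (rsubmx p.1 *m y) 0 0) / h p.
  have [x x'|t [Nt tP]] := @exists_between _ (map rest N) (map rest P).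
    move=> /mapP[q qN ->] /mapP[p pP ->].
    have := sy (tl (comb p q)); rewrite mem_cat orbC allpairs_f // => /(_ isT).
    move: pP qN; rewrite !mem_filter => /andP[p0 _] /andP[q0 _].
    rewrite /satisfies /tl /= linearD !linearZ /= mulmxDl -!scalemxAl.
    rewrite [(_ + _ : 'M__) 0 0]mxE ![(_ *: _ : 'M__) 0 0]mxE.
    rewrite /rest ler_ndivrMr // mulrAC ler_pdivrMr //.
    move: (_ 0 0) (_ 0 0) (h p) (h q) q.2 p.2.
    by rewrite /GRing.regular /GRing.scale /= => u v hp hq dq dp; lra.
  exists (col_mx (const_mx t : 'cV_1) y : 'cV_(1 + n)) => p ps; rewrite /satisfies.
  rewrite -[p.1](@hsubmxK _ 1 1 n) (@mul_row_col _ 1 1 n) mxE.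
  have -> : (lsubmx (p.1 : 'rV_(1 + n)) *m const_mx t : 'M_1) 0 0 = h p * t.
    by rewrite mxE big_ord1 !mxE /h; congr (p.1 _ _ * _); apply: val_inj.
  have [p0|p0|p0] := ltgtP (h p) 0.
  + have : rest p <= t by apply: Nt; rewrite map_f // mem_filter p0.
    by rewrite /rest ler_ndivrMr // mulrC; lra.
  + have : t <= rest p by apply: tP; rewrite map_f // mem_filter p0.
    by rewrite /rest ler_pdivlMr // mulrC; lra.
  + have := sy (tl p); rewrite mem_cat map_f ?mem_filter ?p0 ?eqxx // => /(_ isT).
    by rewrite mul0r add0r.
right; exists e => // C [C0 CD CZ] sC.
have row0 : row_mx (0 : 'M_1) (0 : 'rV[R]_n) = 0 by rewrite row_mx0.
have tlC p : h p = 0 -> C p -> C (row_mx (0 : 'M_1) (tl p).1, (tl p).2).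
  move=> hp; congr C; case: p hp => a d /= hp; congr pair.
  rewrite -[LHS](@hsubmxK R 1 1 n a); suff -> : lsubmx a = 0 by [].
  apply/matrixP=> i j.
  by rewrite !mxE !ord1 -hp /h; congr (a _ _); apply: val_inj.
(* The cone used for the reduced system is the preimage of [C] under insertion of a zero first
   coefficient. *)
have := eC (fun q => C (row_mx (0 : 'M_1) q.1, q.2)); rewrite /= row0; apply.
  split=> [|v w Cv Cw|a v a0 Cv] /=; first by rewrite row0.
  - have := CD _ _ Cv Cw; congr C.
    by apply: injective_projections; rewrite //= add_row_mx addr0.
  - have := CZ a _ a0 Cv; congr C.
    by apply: injective_projections; rewrite //= scale_row_mx scaler0.
move=> q; rewrite mem_cat => /orP[/mapP[p + ->]|/allpairsP[[p p'] [/= + + ->]]].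
  by rewrite mem_filter => /andP[/eqP p0 ps]; apply/tlC/sC.
rewrite !mem_filter => /andP[p0 ps] /andP[p'0 p's]; apply: tlC.
  by rewrite /h /= !mxE -/(h p) -/(h p'); ring.
by apply: CD; apply: CZ; rewrite ?oppr_ge0 ?ltW //; apply: sC.
Qed.

End Alternative.

Lemma dotDr (R : realType) p (u v w : 'cV[R]_p) :
  dot u (v + w) = dot u v + dot u w.
Proof. by rewrite /dot mulmxDr mxE. Qed.

Lemma dotZr (R : realType) p (u v : 'cV[R]_p) a : dot u (a *: v) = a * dot u v.
Proof. by rewrite /dot -scalemxAr mxE. Qed.

Section Duality.
Variables (R : realType) (m n : nat) (B : 'M[R]_(n, m)) (b : 'cV[R]_n).

(** Elimination is applied to the rows of [B^T y <= c] together with [- b^T y <= - r]; [x] and [t]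
    are the multipliers of a contradictory combination. *)
Lemma dual_alternative (c : 'cV[R]_m) (r : R) :
  (exists y, B^T *m y <=mx c /\ r <= dot b y) \/
  (exists x t, [/\ 0 <=mx x, 0 <= t, B *m x = t *: b & dot c x < t * r]).
Proof.
have [[y sy]|[e e0 eC]] := @fourier_motzkin R n
  ((- b^T, - r) :: [seq (row i B^T, c i 0) | i <- enum 'I_m]).
  left; exists y; split.
    move=> i j; rewrite ord1; have := sy (row i B^T, c i 0).
    rewrite inE (map_f (fun i => (row i B^T, c i 0))) ?mem_enum // orbT.
    by move=> /(_ isT); rewrite /satisfies /= -row_mul mxE.
  have := sy _ (mem_head _ _).
  by rewrite /satisfies /= mulNmx mxE lerN2.
right.
(* The cone generated by the system, with its multipliers made explicit. *)
pose C (q : 'rV[R]_n * R^o) := exists (x : 'cV[R]_m) t,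
  [/\ 0 <=mx x, 0 <= t, q.1 = x^T *m B^T - t *: b^T & q.2 = dot c x - t * r].
have [|p|x [t [x0 t0 xt xe]]] := eC C.
- split.
  + exists 0, 0; split=> //=; first by rewrite trmx0 mul0mx scale0r subr0.
    by rewrite /dot mulmx0 mxE mul0r subr0.
  + move=> v w [x [t [x0 t0 v1 v2]]] [x' [t' [x'0 t'0 w1 w2]]].
    exists (x + x'), (t + t'); split => [i j||/=|/=].
    * by have := x0 i j; have := x'0 i j; rewrite !mxE; lra.
    * exact: addr_ge0.
    * by rewrite v1 w1 linearD mulmxDl scalerDl opprD addrACA.
    * by rewrite v2 w2 dotDr; ring.
  + move=> a v a0 [x [t [x0 t0 vE wE]]].
    exists (a *: x), (a * t); split => [i j||/=|/=].
    * by have := x0 i j; rewrite !mxE; apply: mulr_ge0.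
    * exact: mulr_ge0.
    * by rewrite vE [(a *: x)^T]linearZ /= -scalemxAl scalerBr scalerA.
    * by rewrite dotZr wE /GRing.scale /=; ring.
- rewrite inE => /predU1P[->|/mapP[i _ ->]].
    exists 0, 1; split=> //=; first by rewrite trmx0 mul0mx scale1r sub0r.
    by rewrite /dot mulmx0 mxE mul1r sub0r.
  exists (delta_mx i 0), 0; split=> [k l||/=|/=] //.
  + by rewrite !mxE ler0n.
  + by rewrite trmx_delta -rowE scale0r subr0.
  + by rewrite /dot -colE !mxE mul0r subr0.
exists x, t; split=> //; last by rewrite -subr_lt0 -xe.
apply/trmx_inj/eqP; rewrite trmx_mul -subr_eq0 linearZ /=.
by rewrite -xt.
Qed.

Lemma Kbar_scale x t : 0 < t -> 0 <=mx x -> B *m x = t *: b ->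
  Kbar B b (t^-1 *: x).
Proof.
move=> t0 x0 xt; split=> [i j|].
  by have := x0 i j; rewrite !mxE => x_ge0; rewrite mulr_ge0 // invr_ge0 ltW.
by rewrite -scalemxAr xt scalerA mulVf ?scale1r // gt_eqF.
Qed.

(** The alternative at cost 0 and level 1: its second case reads [0 < t], so [x] can be rescaled
    into [Kbar]. *)
Lemma Kbar_farkas : (exists x, Kbar B b x) \/
  (exists y, B^T *m y <=mx 0 /\ 0 < dot b y).
Proof.
have [[y [yB yb]]|[x [t [x0 t0 xt]]]] := dual_alternative 0 1.
  by right; exists y; split=> //; apply: lt_le_trans yb.
rewrite /dot trmx0 mul0mx mxE mulr1 => t_gt0.
by left; exists (t^-1 *: x); apply: Kbar_scale.
Qed.

(** Otherwise there are multipliers [x], [t]. If [t > 0], rescaling [x] gives a point of [Kbar] of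
    cost below [r]; if [t = 0], moving from [x0] along [x] brings the cost down to at most
    [r - 1]. *)
Lemma strong_duality (c : 'cV[R]_m) (r : R) (x0 : 'cV[R]_m) :
  Kbar B b x0 -> (forall x, Kbar B b x -> r <= dot c x) ->
  exists y, B^T *m y <=mx c /\ r <= dot b y.
Proof.
move=> [x0_ge0 Bx0] Kr.
have [//|[x [t [x_ge0 t0 xt xc]]]] := dual_alternative c r.
have [t_eq0|t_neq0] := eqVneq t 0; last first.
  have t_gt0 : 0 < t by rewrite lt0r t_neq0.
  have := Kr _ (Kbar_scale t_gt0 x_ge0 xt).
  by rewrite dotZr mulrC ler_pdivlMr // mulrC leNgt xc.
move: xt xc; rewrite t_eq0 scale0r mul0r => Bx cx.
(* [x] is a recession direction of [Kbar] along which [c] decreases. *)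
pose a := Num.max 0 ((r - 1 - dot c x0) / dot c x).
have a0 : 0 <= a by rewrite le_max lexx.
have ac : a * dot c x <= r - 1 - dot c x0.
  by rewrite -ler_ndivrMr // le_max lexx orbT.
have : Kbar B b (x0 + a *: x).
  split=> [i j|]; last by rewrite mulmxDr -scalemxAr Bx Bx0 scaler0 addr0.
  have := x0_ge0 i j; have := x_ge0 i j; rewrite !mxE => xij x0ij.
  by rewrite addr_ge0 // mulr_ge0.
by move=> /Kr; rewrite dotDr dotZr; lra.
Qed.

(** Adding a Farkas ray to column [k] of [Y] would keep feasibility and improve an optimal value. *)
Lemma dual_update_Kbar_nonempty (M : 'M[R]_m) Y z (k : 'I_m) :
  dual_update B b M Y z -> exists x, Kbar B b x.
Proof.
move=> /(_ k)[feas opt]; have [//|[y [yB yb]]] := Kbar_farkas.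
have /opt : dual_feasible B (col k M) k (col k Y + y) (z k 0).
  move=> i j; have := feas i j; have := yB i j.
  by rewrite mulmxDr [(_ + _ + _ : 'M__) i j]mxE ![(_ + _ : 'M__) i j]mxE !mxE; lra.
by rewrite dotDr; lra.
Qed.

Lemma dual_update_Mbar_le (M : 'M[R]_m) Y z :
  dual_update B b M Y z -> Mbar B Y z <=mx M.
Proof.
move=> upd i k; have [/(_ i 0) + _] := upd k.
rewrite !mxE; congr (_ + _ <= _).
  by apply: eq_bigr => j _; rewrite !mxE.
by case: eqVneq => [->|_]; rewrite ?mulr1 ?mulr0.
Qed.

(** [cbar] and [Mbar] are linear in [(Y, z)], so the updates telescope; [W] is the sum of the
    matrices [S] of the run. *)
Lemma GGL_run_sum (M : 'M[R]_m) c c' : GGL_run B b M c c' ->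
  exists Y z W, [/\ W^T = - W, c' = c + cbar b Y z & Mbar B Y z <=mx M + W].
Proof.
elim=> {M c c'} [M c Y z upd _|M c Y z S c' upd _ skewS _].
  exists Y, z, 0; split=> //; first by rewrite trmx0 oppr0.
  by rewrite addr0; apply: dual_update_Mbar_le.
move=> [Y' [z' [W [skewW -> MW]]]]; exists (Y + Y'), (z + z'), (S + W); split.
- by rewrite linearD /= skewS skewW opprD.
- by rewrite /cbar linearD /= mulmxDl -addrA [X in _ + X]addrACA.
move=> i j; have := MW i j; rewrite /Mbar !linearD /=.
by rewrite !mxE; lra.
Qed.

Lemma GGL_run_dual_update (M : 'M[R]_m) c c' : GGL_run B b M c c' ->
  exists Y z, dual_update B b M Y z.
Proof. by case=> {M c c'} M c Y z *; exists Y, z. Qed.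

(** Averaging the entries [(i, j)] and [(j, i)] of the bound on [Mbar] cancels [W]; the half on [Y]
    comes from this average and absorbs the factor 2 in front of [Y^T b]. *)
Lemma LBB_feasible_half (Q W : 'M[R]_m) Y z y : W^T = - W ->
  Mbar B Y z <=mx Q + W -> B^T *m y <=mx cbar b Y z ->
  LBB_feasible B b Q (2^-1 *: Y) z y.
Proof.
move=> skewW QW yc; split.
  by rewrite linearZ /= -scalemxAl scalerA divff ?scale1r // pnatr_eq0.
have YB : Y^T *m B = (B^T *m Y)^T by rewrite trmx_mul trmxK.
move=> i j; rewrite [(_ *: _)^T]linearZ /= -scalemxAr -scalemxAl YB.
have := QW i j; have := QW j i.
have : W j i = - W i j by have := congr1 (fun A : 'M_m => A i j) skewW; rewrite !mxE.
rewrite /Mbar /symmetrize; move: (B^T *m Y) => A; rewrite !mxE.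
case: (eqVneq i j) => [->|_]; rewrite ?mulr1n ?mulr0n; lra.
Qed.

End Duality.

Theorem theorem6p1 (R : realType) (m n : nat)
    (Q : 'M[R]_m) (B : 'M[R]_(n, m)) (b : 'cV[R]_n) (c : 'cV[R]_m) :
  GGL_run B b Q 0 c -> (v_GGL B b c <= v_LBB' B b Q)%E.
Proof.
move=> run; have [Y [z [W [skewW cE QW]]]] := GGL_run_sum run.
rewrite add0r in cE.
(* Comparing through all real lower bounds [r] also covers infinite values of [v_GGL]. *)
suff dual r : (r%:E <= v_GGL B b c)%E ->
    exists y, B^T *m y <=mx c /\ r <= dot b y.
  have lbb r : (r%:E <= v_GGL B b c)%E -> (r%:E <= v_LBB' B b Q)%E.
    move=> /dual[y [yc ry]]; apply: (@le_trans _ _ (dot b y)%:E) => //.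
    apply: ereal_sup_ubound; exists (2^-1 *: Y), z, y; split=> //.
    by apply: LBB_feasible_half skewW QW _; rewrite -cE.
  case: (v_GGL B b c) lbb => [r|lbb|_]; first exact.
    by rewrite (@eq_infty _ (v_LBB' B b Q)) // => r; apply: lbb; rewrite leey.
  exact: leNye.
move=> r_le.
have Kr x : Kbar B b x -> r <= dot c x.
  move=> Kx; rewrite -lee_fin; apply: le_trans r_le _.
  by apply: ereal_inf_lbound; exists x.
have [k _|m0] := pickP (@predT 'I_m).
  have [Y' [z' upd]] := GGL_run_dual_update run.
  have [x0 Kx0] := dual_update_Kbar_nonempty k upd.
  exact: strong_duality Kx0 Kr.
(* For [m = 0] the scheme solves no linear program, so [Kbar] may be empty; then [B^T y <= c] is
   vacuous and a multiple of the ray reaches [r]. *)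
have [[x0 Kx0]|[y [_ yb]]] := Kbar_farkas B b; first exact: strong_duality Kx0 Kr.
exists ((r / dot b y) *: y); split=> [k|]; first by have := m0 k.
by rewrite dotZr divfK // gt_eqF.
Qed.
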